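(* Topological search is correct: when an arc $(v,w)$ with $\mathit{position}(v)>\mathit{position}(w)$ is added to an acyclic graph whose vertex numbering is topological, the cycle test reports a cycle if and only if the addition of $(v,w)$ creates one; and if it does not, the reordering step terminates and produces a numbering (a bijection from the vertices to $\{1,\dots,n\}$) that is topological for the graph including $(v,w)$.
   Context: The vertices are numbered by a bijection $\mathit{position}$ onto $\{1,\dots,n\}$ with inverse array $\mathit{vertex}$; the numbering is topological if every arc $(x,y)$ has $\mathit{position}(x)<\mathit{position}(y)$. Arcs are tested in $\mathrm{O}(1)$ time via an adjacency matrix. Queues support inject (add at back) and pop (remove and return front, null if empty). Topological search for new arc $(v,w)$: $F=[w]$, $B=[v]$, $i=\mathit{position}(w)$, $j=\mathit{position}(v)$, set $\mathit{vertex}(i)=\mathit{vertex}(j)=$ null. Repeat: $i=i+1$; while $i<j$ and no $u\in F$ has an arc $(u,\mathit{vertex}(i))$, set $i=i+1$; if $i=j$ stop; else inject $\mathit{vertex}(i)$ into $F$ and set $\mathit{vertex}(i)=$ null. Then $j=j-1$; while $i<j$ and no $z\in B$ has an arc $(\mathit{vertex}(j),z)$, set $j=j-1$; if $i=j$ stop; else inject $\mathit{vertex}(j)$ into $B$ and set $\mathit{vertex}(j)=$ null. Cycle test: after the search, report a cycle iff there is an arc $(u,z)$ with $u\in F$, $z\in B$. Reordering (if no cycle), starting from the final values of $F,B,i,j$: while $F$ is nonempty: if $\mathit{vertex}(i)\ne$ null and some $u$ currently in $F$ has an arc $(u,\mathit{vertex}(i))$, inject $\mathit{vertex}(i)$ into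 $F$ and set $\mathit{vertex}(i)=$ null; if $\mathit{vertex}(i)=$ null, pop $x$ from $F$ and set $\mathit{vertex}(i)=x$, $\mathit{position}(x)=i$; then $i=i+1$. While $B$ is nonempty: $j=j-1$; if $\mathit{vertex}(j)\ne$ null and there is an arc $(\mathit{vertex}(j),z)$ with $z$ currently in $B$, inject $\mathit{vertex}(j)$ into $B$ and set $\mathit{vertex}(j)=$ null; if $\mathit{vertex}(j)=$ null, pop $y$ from $B$ and set $\mathit{vertex}(j)=y$, $\mathit{position}(y)=j$. *)

(* Defs.v *)
From mathcomp Require Import all_boot.
Set Implicit Arguments.
Unset Strict Implicit.
Unset Printing Implicit Defensive.

(* A directed graph is a finite type V of vertices with its (boolean)
   adjacency matrix [arc : rel V]; n is #|V|. *)

Definition add_arc (V : finType) (arc : rel V) (v w : V) : rel V :=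
  fun x y => arc x y || ((x == v) && (y == w)).

(* [cycle arc (x :: p)] also covers loops (p = [::]). *)
Definition has_cycle (V : finType) (arc : rel V) : Prop :=
  exists (x : V) (p : seq V), cycle arc (x :: p).

Definition acyclic (V : finType) (arc : rel V) : Prop := ~ has_cycle arc.

Definition topological (V : finType) (arc : rel V) (position : V -> nat) :
  Prop := forall x y : V, arc x y -> position x < position y.

(* Arrays are functions; [None] in the array [vertex] is the null entry.  Only
   the entries [vertex k] with 1 <= k <= n are meaningful, and the algorithm
   below fails if it reads any other. *)
Record numbering (V : finType) (position : V -> nat)
    (vertex : nat -> option V) : Prop := Numbering {
  position_range : forall x : V, 1 <= position x <= #|V|;
  position_inj : injective position;
  position_surj :
    forall k : nat, 1 <= k <= #|V| -> exists x : V, position x = k;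
  vertex_position : forall x : V, vertex (position x) = Some x
}.

(* The content of all the program variables.  Queues have their front at the
   head of the list, so inject is [rcons]. *)
Record state (V : finType) := State {
  st_position : V -> nat;
  st_vertex : nat -> option V;
  st_F : seq V;
  st_B : seq V;
  st_i : nat;
  st_j : nat
}.

(* Programs are partial functions into an option type, [None] being either a
   run-time error (reading [vertex] outside 1..n, or using a null entry as a
   vertex) or exhaustion of the fuel that bounds the number of iterations of
   each loop. *)
Notation "'let?' x ':=' a 'in' b" := (obind (fun x => b) a)
  (at level 200, x name, a at level 200, b at level 200).

(* [prog] terminates without error in the state [s]. *)
Definition terminates_in (S : Type) (prog : nat -> option S) (s : S) : Prop :=
  exists fuel0 : nat, forall fuel : nat, fuel0 <= fuel -> prog fuel = Some s.

Fixpoint while (S : Type) (guard : S -> option bool) (body : S -> option S)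
    (fuel : nat) (s : S) : option S :=
  if fuel is fuel'.+1 then
    let? b := guard s in
    if b then let? s' := body s in while guard body fuel' s' else Some s
  else None.

Definition read (V : finType) (vertex : nat -> option V) (k : nat) :
  option (option V) := if 1 <= k <= #|V| then Some (vertex k) else None.

(* The vertex stored at a non-null entry; an error if the entry is null. *)
Definition read_vertex (V : finType) (vertex : nat -> option V) (k : nat) :
  option V := let? o := read vertex k in o.

Definition set_i (V : finType) (s : state V) (k : nat) : state V :=
  let: State pos vtx F B i j := s in State pos vtx F B k j.

Definition set_j (V : finType) (s : state V) (k : nat) : state V :=
  let: State pos vtx F B i j := s in State pos vtx F B i k.

Definition inject_F (V : finType) (s : state V) (x : V) : state V :=
  let: State pos vtx F B i j := s in
  State pos [eta vtx with i |-> None] (rcons F x) B i j.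

Definition inject_B (V : finType) (s : state V) (y : V) : state V :=
  let: State pos vtx F B i j := s in
  State pos [eta vtx with j |-> None] F (rcons B y) i j.

(* Is there an arc from a vertex of F to x / from y to a vertex of B? *)
Definition arc_from_F (V : finType) (arc : rel V) (s : state V) (x : V) :
  bool := has (fun u => arc u x) (st_F s).

Definition arc_to_B (V : finType) (arc : rel V) (s : state V) (y : V) :
  bool := has (fun z => arc y z) (st_B s).

(* While i < j and no u in F has an arc (u, vertex(i)), increment i.  As the
   conjunction is evaluated from left to right, vertex(i) is read only when
   i < j; similarly for vertex(j) in [scan_B]. *)
Definition scan_F (V : finType) (arc : rel V) : nat -> state V ->
    option (state V) :=
  while
    (fun s => if st_i s < st_j s then
                let? x := read_vertex (st_vertex s) (st_i s) in
                Some (~~ arc_from_F arc s x)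
              else Some false)
    (fun s => Some (set_i s (st_i s).+1)).

Definition scan_B (V : finType) (arc : rel V) : nat -> state V ->
    option (state V) :=
  while
    (fun s => if st_i s < st_j s then
                let? y := read_vertex (st_vertex s) (st_j s) in
                Some (~~ arc_to_B arc s y)
              else Some false)
    (fun s => Some (set_j s (st_j s).-1)).

Fixpoint search_loop (V : finType) (arc : rel V) (fuel : nat) (s : state V) :
    option (state V) :=
  if fuel is fuel'.+1 then
    let? s1 := scan_F arc fuel' (set_i s (st_i s).+1) in
    if st_i s1 == st_j s1 then Some s1 else
    let? x := read_vertex (st_vertex s1) (st_i s1) in
    let s2 := inject_F s1 x in
    let? s3 := scan_B arc fuel' (set_j s2 (st_j s2).-1) in
    if st_i s3 == st_j s3 then Some s3 else
    let? y := read_vertex (st_vertex s3) (st_j s3) in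
    search_loop arc fuel' (inject_B s3 y)
  else None.

Definition search (V : finType) (arc : rel V) (position : V -> nat)
    (vertex : nat -> option V) (v w : V) (fuel : nat) : option (state V) :=
  let i := position w in
  let j := position v in
  search_loop arc fuel
    (State position [eta vertex with i |-> None, j |-> None]
       [:: w] [:: v] i j).

Definition cycle_test (V : finType) (arc : rel V) (s : state V) : bool :=
  has (fun u => has (fun z => arc u z) (st_B s)) (st_F s).

(* Pop x from F, then set vertex(i) = x and position(x) = i. *)
Definition place_F (V : finType) (s : state V) : option (state V) :=
  let: State pos vtx F B i j := s in
  if F is x :: F' then
    Some (State [eta pos with x |-> i] [eta vtx with i |-> Some x] F' B i j)
  else None.

Definition place_B (V : finType) (s : state V) : option (state V) :=
  let: State pos vtx F B i j := s in
  if B is y :: B' then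
    Some (State [eta pos with y |-> j] [eta vtx with j |-> Some y] F B' i j)
  else None.

Definition reorder_F_body (V : finType) (arc : rel V) (s : state V) :
    option (state V) :=
  let? o := read (st_vertex s) (st_i s) in
  let s1 := if o is Some x then
              if arc_from_F arc s x then inject_F s x else s
            else s in
  let? o1 := read (st_vertex s1) (st_i s1) in
  let? s2 := if o1 is None then place_F s1 else Some s1 in
  Some (set_i s2 (st_i s2).+1).

Definition reorder_B_body (V : finType) (arc : rel V) (s : state V) :
    option (state V) :=
  let s0 := set_j s (st_j s).-1 in
  let? o := read (st_vertex s0) (st_j s0) in
  let s1 := if o is Some y then
              if arc_to_B arc s0 y then inject_B s0 y else s0
            else s0 in
  let? o1 := read (st_vertex s1) (st_j s1) in
  if o1 is None then place_B s1 else Some s1.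

Definition reorder (V : finType) (arc : rel V) (s : state V) (fuel : nat) :
    option (state V) :=
  let? s' := while (fun s => Some (st_F s != [::])) (reorder_F_body arc)
               fuel s in
  while (fun s => Some (st_B s != [::])) (reorder_B_body arc) fuel s'.

(* Main.v *)
(* A single invariant governs both search and reordering.  Call a vertex free if
   it is in neither queue.  For cut points i and j: arcs between free vertices
   go up; an arc from F to a free vertex ends at a position >= i and one from a
   free vertex to F starts below i; likewise for B with j in place of i, each in
   the direction required by placing B just below j; and each queue is listed
   in an order compatible with the arcs inside it.  Search stops with i = j = t
   and as many null entries >= t (resp. < t) as elements of F (resp. B).  If no
   arc goes from F to B, the invariant survives reordering, and with both queues
   empty it says that the new numbering is topological.  Hence a negative cycle
   test excludes cycles without any analysis of paths; conversely an arc from F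
   to B closes a cycle, as w reaches F and B reaches v. *)
Require Import Defs.
From mathcomp Require Import all_boot.
From mathcomp Require Import zify.

Set Implicit Arguments.
Unset Strict Implicit.
Unset Printing Implicit Defensive.

(** * Termination of loops with fuel *)

(** A total-correctness rule with loop invariant [P], postcondition [Q] and variant [m]. The variant
    bounds the number of iterations and each of them costs one unit of fuel, so every large enough
    fuel gives the same final state. *)
Lemma while_terminates (S : Type) (guard : S -> option bool)
    (body : S -> option S) (P Q : S -> Prop) (m : S -> nat) (s : S) :
  (forall s, P s ->
     (guard s = Some false /\ Q s) \/
     (guard s = Some true /\
      exists s', [/\ body s = Some s', P s' & m s' < m s])) ->
  P s -> exists2 s', terminates_in (while guard body ^~ s) s' & Q s'.
Proof.
move=> step; have [n] := ubnP (m s); elim: n s => // n IH s ltn Ps.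
have [[gs Qs]|[gs [s1 [bs Ps1 lt1]]]] := step s Ps.
  by exists s => //; exists 1; case=> //= fuel _; rewrite gs.
have [|s' [f0 Hf0] Qs'] := IH s1 _ Ps1; first by lia.
by exists s' => //; exists f0.+1; case=> //= fuel lef; rewrite gs /= bs /= Hf0.
Qed.

(** * Counting null entries in half-open ranges of positions *)

Definition nulls (V : finType) (f : nat -> option V) (a b : nat) : nat :=
  \sum_(a <= k < b) (f k == None).

Lemma nulls_set (V : finType) (f : nat -> option V) (a b k : nat) o :
  ~~ (a <= k < b) -> nulls [eta f with k |-> o] a b = nulls f a b.
Proof.
move=> nk; rewrite /nulls; apply: eq_big_nat => l lab /=.
by case: (l =P k) => // elk; rewrite -elk lab in nk.
Qed.

Lemma nulls_recl (V : finType) (f : nat -> option V) (a b : nat) :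
  a < b -> nulls f a b = (f a == None) + nulls f a.+1 b.
Proof. exact: big_ltn. Qed.

Lemma nulls_recr (V : finType) (f : nat -> option V) (a b : nat) :
  a <= b -> nulls f a b.+1 = nulls f a b + (f b == None).
Proof. exact: big_nat_recr. Qed.

Lemma nulls_skip_l (V : finType) (f : nat -> option V) (a b c : nat) :
  a <= b <= c -> (forall k, a <= k < b -> f k != None) ->
  nulls f a c = nulls f b c.
Proof.
case/andP=> ab bc nn; rewrite /nulls (big_cat_nat ab bc) /=.
by rewrite big_nat big1 // => k /nn /negbTE ->.
Qed.

Lemma nulls_skip_r (V : finType) (f : nat -> option V) (a b c : nat) :
  a <= b <= c -> (forall k, b <= k < c -> f k != None) ->
  nulls f a c = nulls f a b.
Proof.
case/andP=> ab bc nn; rewrite /nulls (big_cat_nat ab bc) /= addnC.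
by rewrite big_nat big1 // => k /nn /negbTE ->.
Qed.

(** * The invariant *)

(** A [numbering] weakened for use in mid-run: the position of a queued vertex is stale, hence
    unconstrained, and no entry in range holds such a vertex. *)
Record consistent (V : finType) (pos : V -> nat) (vtx : nat -> option V)
    (F B : seq V) : Prop := Consistent {
  cs_uniq : uniq (F ++ B);
  cs_range : forall x, x \notin F ++ B -> 1 <= pos x <= #|V|;
  cs_vtx : forall x, x \notin F ++ B -> vtx (pos x) = Some x;
  cs_queue : forall k x, 1 <= k <= #|V| -> vtx k = Some x -> x \notin F ++ B;
  cs_pos : forall k x, 1 <= k <= #|V| -> vtx k = Some x -> pos x = k
}.

(* F will be placed, in queue order, at positions >= i, and B, in reverse queue
   order, at positions < j. *)
Record ordered (V : finType) (arc : rel V) (pos : V -> nat) (F B : seq V)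
    (i j : nat) : Prop := Ordered {
  or_FF : pairwise (fun x y => ~~ arc y x) F;
  or_BB : pairwise (fun x y => ~~ arc x y) B;
  or_out : forall x y, x \notin F ++ B -> y \notin F ++ B ->
    arc x y -> pos x < pos y;
  or_Fout : forall x y, x \in F -> y \notin F ++ B -> arc x y -> i <= pos y;
  or_outF : forall x y, x \notin F ++ B -> y \in F -> arc x y -> pos x < i;
  or_outB : forall x y, x \notin F ++ B -> y \in B -> arc x y -> pos x < j;
  or_Bout : forall x y, x \in B -> y \notin F ++ B -> arc x y -> j <= pos y
}.

(** A negative cycle test in propositional form. It stays outside [invariant] because the search
    does not maintain it. *)
Definition separated (V : finType) (arc : rel V) (F B : seq V) : Prop :=
  forall x y, x \in F -> y \in B -> ~~ arc x y.

Definition invariant (V : finType) (arc : rel V) pos vtx F B i j : Prop :=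
  @consistent V pos vtx F B /\ ordered arc pos F B i j.

(** * Effect of scanning, injecting and placing on the invariant *)

(** The queues are related only up to permutation, so that the same lemma serves [F] and [B]. *)
Lemma consistent_inject (V : finType) pos vtx (F B F' B' : seq V) k x :
  perm_eq (F' ++ B') (x :: F ++ B) -> 1 <= k <= #|V| -> vtx k = Some x ->
  consistent pos vtx F B -> consistent pos [eta vtx with k |-> None] F' B'.
Proof.
move=> pE kr vk [un rg vt qu ps].
have mE y : (y \in F' ++ B') = (y == x) || (y \in F ++ B).
  by rewrite (perm_mem pE) inE.
split.
- by rewrite (perm_uniq pE) /= un (qu _ _ kr vk).
- by move=> y; rewrite mE negb_or => /andP[_ /rg].
- move=> y; rewrite mE negb_or => /andP[/eqP nyx yQ] /=.
  case: eqP => [pk|_]; last exact: vt.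
  by case: nyx; move: (vt y yQ); rewrite pk vk => -[].
- move=> l y lr /=; case: eqP => // nlk vl; rewrite mE negb_or (qu _ _ lr vl) andbT.
  apply/eqP => yx; apply: nlk.
  by rewrite -(ps _ _ lr vl) yx (ps _ _ kr vk).
- by move=> l y lr /=; case: eqP => // _; apply: ps.
Qed.

Lemma consistent_place (V : finType) pos vtx (F B F' B' : seq V) k x :
  perm_eq (F ++ B) (x :: F' ++ B') -> 1 <= k <= #|V| -> vtx k = None ->
  consistent pos vtx F B ->
  consistent [eta pos with x |-> k] [eta vtx with k |-> Some x] F' B'.
Proof.
move=> pE kr vk [un rg vt qu ps].
have mE y : (y \in F ++ B) = (y == x) || (y \in F' ++ B').
  by rewrite (perm_mem pE) inE.
move: un; rewrite (perm_uniq pE) /= => /andP[xQ un].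
split=> //.
- by move=> y yQ /=; case: eqP => // /eqP nyx; apply: rg; rewrite mE negb_or nyx.
- move=> y yQ /=; case: (eqVneq y x) => [->|nyx]; first by rewrite eqxx.
  have yQ' : y \notin F ++ B by rewrite mE negb_or nyx.
  by case: eqP => [pk|_]; [move: (vt y yQ'); rewrite pk vk | apply: vt].
- move=> l y lr /=; case: eqP => [_ [<-] //|_ vl].
  by move: (qu _ _ lr vl); rewrite mE negb_or => /andP[].
- move=> l y lr /=; case: (l =P k) => [-> [->]|_ vl]; first by rewrite eqxx.
  by move: (qu _ _ lr vl); rewrite mE negb_or => /andP[/negbTE -> _]; apply: ps.
Qed.

(** Raising the cut relaxes the bound on arcs into [F] and tightens the one on arcs out of [F]; the
    latter can fail only at a vertex stored at [i]. If that entry is null, the hypothesis holds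
    vacuously. *)
Lemma invariant_skip_F (V : finType) (arc : rel V) pos vtx F B i j :
  (forall x, vtx i = Some x -> ~~ has (arc^~ x) F) ->
  invariant arc pos vtx F B i j -> invariant arc pos vtx F B i.+1 j.
Proof.
move=> noarc [cs [FF BB oo Fo oF oB Bo]]; split=> //; split=> //.
- move=> x y xF yQ xy; rewrite ltn_neqAle (Fo _ _ xF yQ xy) andbT.
  apply/eqP => iE; have := cs_vtx cs yQ; rewrite -iE => /noarc.
  by move/hasPn => /(_ _ xF); rewrite xy.
- by move=> x y xQ yF xy; rewrite ltnS ltnW ?(oF _ _ xQ yF xy).
Qed.

(** [B] goes strictly below its cut, so the cut is still [j.+1] while entry [j] is examined. *)
Lemma invariant_skip_B (V : finType) (arc : rel V) pos vtx F B i j :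
  (forall x, vtx j = Some x -> ~~ has (arc x) B) ->
  invariant arc pos vtx F B i j.+1 -> invariant arc pos vtx F B i j.
Proof.
move=> noarc [cs [FF BB oo Fo oF oB Bo]]; split=> //; split=> //.
- move=> x y xQ yB xy; have := oB _ _ xQ yB xy.
  rewrite ltnS leq_eqVlt => /predU1P[jE|//].
  have := cs_vtx cs xQ; rewrite jE => /noarc.
  by move/hasPn => /(_ _ yB); rewrite xy.
- by move=> x y xB yQ xy; rewrite ltnW ?(Bo _ _ xB yQ xy).
Qed.

(** [x] sits exactly at the cut [i] and free arcs go up, so arcs from free vertices to [x] start
    below [i] and arcs from [x] to free vertices end above it. An arc from [x] into [F] would have
    to start below [i], so [x] may stand last in the queue. *)
Lemma invariant_inject_F (V : finType) (arc : rel V) pos vtx F B i j x :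
  1 <= i <= #|V| -> vtx i = Some x -> invariant arc pos vtx F B i j ->
  invariant arc pos [eta vtx with i |-> None] (rcons F x) B i j.
Proof.
move=> ir vi [cs [FF BB oo Fo oF oB Bo]].
have pE : perm_eq (rcons F x ++ B) (x :: F ++ B).
  by rewrite -cats1 -catA /= perm_catC /= perm_cons perm_catC.
split; first exact: consistent_inject pE ir vi cs.
have mE y : (y \notin rcons F x ++ B) = (y != x) && (y \notin F ++ B).
  by rewrite (perm_mem pE) inE negb_or.
have xQ := cs_queue cs ir vi.
have px := cs_pos cs ir vi.
split=> //.
- rewrite pairwise_rcons FF andbT; apply/allP => y yF; apply/negP => xy.
  by have := oF _ _ xQ yF xy; rewrite px ltnn.
- by move=> y z; rewrite !mE => /andP[_ yQ] /andP[_ zQ]; apply: oo.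
- move=> y z; rewrite mem_rcons inE mE => /predU1P[->|yF] /andP[_ zQ] yz.
    by rewrite -px ltnW ?oo.
  exact: Fo yz.
- move=> y z; rewrite mem_rcons inE mE => /andP[_ yQ] /predU1P[->|zF] yz.
    by rewrite -px oo.
  exact: oF yz.
- by move=> y z; rewrite mE => /andP[_ yQ]; apply: oB.
- by move=> y z yB; rewrite mE => /andP[_ zQ]; apply: Bo.
Qed.

(** [x] sits just below the cut [j.+1]; an arc from [B] to [x] would have to end at or above that
    cut, so [x] may stand last. *)
Lemma invariant_inject_B (V : finType) (arc : rel V) pos vtx F B i j x :
  1 <= j <= #|V| -> vtx j = Some x -> invariant arc pos vtx F B i j.+1 ->
  invariant arc pos [eta vtx with j |-> None] F (rcons B x) i j.+1.
Proof.
move=> jr vj [cs [FF BB oo Fo oF oB Bo]].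
have pE : perm_eq (F ++ rcons B x) (x :: F ++ B).
  by rewrite -rcons_cat perm_rcons.
split; first exact: consistent_inject pE jr vj cs.
have mE y : (y \notin F ++ rcons B x) = (y != x) && (y \notin F ++ B).
  by rewrite (perm_mem pE) inE negb_or.
have xQ := cs_queue cs jr vj.
have px := cs_pos cs jr vj.
split=> //.
- rewrite pairwise_rcons BB andbT; apply/allP => y yB; apply/negP => yx.
  by have := Bo _ _ yB xQ yx; rewrite px ltnn.
- by move=> y z; rewrite !mE => /andP[_ yQ] /andP[_ zQ]; apply: oo.
- by move=> y z yF; rewrite mE => /andP[_ zQ]; apply: Fo.
- by move=> y z; rewrite mE => /andP[_ yQ]; apply: oF.
- move=> y z; rewrite mem_rcons inE mE => /andP[_ yQ] /predU1P[->|zB] yz.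
    by rewrite -px ltnS ltnW ?oo.
  exact: oB yz.
- move=> y z; rewrite mem_rcons inE mE => /predU1P[->|yB] /andP[_ zQ] yz.
    by rewrite -px oo.
  exact: Bo yz.
Qed.

(** An arc from the free vertex [x] into [B] would start below [j], but [x] is at [i]. The bound
    [j <= i] is available during reordering, where the cuts have met or passed each other. *)
Lemma separated_inject_F (V : finType) (arc : rel V) pos vtx F B i j x :
  1 <= i <= #|V| -> vtx i = Some x -> invariant arc pos vtx F B i j ->
  j <= i -> separated arc F B -> separated arc (rcons F x) B.
Proof.
move=> ir vi [cs od] ji sep y z; rewrite mem_rcons inE => /predU1P[->|yF] zB.
  apply/negP => xz.
  have := or_outB od (cs_queue cs ir vi) zB xz.
  by rewrite (cs_pos cs ir vi) ltnNge ji.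
exact: sep.
Qed.

Lemma separated_inject_B (V : finType) (arc : rel V) pos vtx F B i j x :
  1 <= j <= #|V| -> vtx j = Some x -> invariant arc pos vtx F B i j.+1 ->
  j < i -> separated arc F B -> separated arc F (rcons B x).
Proof.
move=> jr vj [cs od] ji sep y z yF; rewrite mem_rcons inE => /predU1P[->|zB].
  apply/negP => yx.
  have := or_Fout od yF (cs_queue cs jr vj) yx.
  by rewrite (cs_pos cs jr vj) leqNgt ji.
exact: sep.
Qed.

(** The front vertex [x] becomes free at position [i]. Free vertices are already on the correct side
    of the cut, and none of them is at [i], as that entry is null. The remaining arcs at [x] concern
    the two queues. *)
Lemma invariant_place_F (V : finType) (arc : rel V) pos vtx F B i j x :
  irreflexive arc -> 1 <= i <= #|V| -> vtx i = None -> j <= i ->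
  separated arc (x :: F) B -> invariant arc pos vtx (x :: F) B i j ->
  invariant arc [eta pos with x |-> i] [eta vtx with i |-> Some x] F B i.+1 j.
Proof.
move=> irr ir vi ji sep [cs [FF BB oo Fo oF oB Bo]].
have pE : perm_eq ((x :: F) ++ B) (x :: F ++ B) by [].
split; first exact: consistent_place pE ir vi cs.
have posi y : y \notin x :: F ++ B -> pos y != i.
  by move=> yQ; apply/eqP => py; have := cs_vtx cs yQ; rewrite py vi.
have outP y : y \notin F ++ B -> y != x -> y \notin x :: F ++ B.
  by move=> yQ nyx; rewrite inE negb_or nyx.
move: FF => /= /andP[/allP xF FF].
have nxF y : y \in F -> y != x.
  move: (cs_uniq cs) => /= /andP[xQ _] yF.
  by apply: contraNneq xQ => <-; rewrite mem_cat yF.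
split=> //.
- move=> y z yQ zQ yz /=.
  case: (eqVneq y x) => [yx|nyx]; case: (eqVneq z x) => [zx|nzx].
  + by rewrite yx zx irr in yz.
  + have zQ' := outP _ zQ nzx; rewrite yx in yz.
    rewrite ltn_neqAle eq_sym (posi _ zQ') /=.
    by apply: Fo yz; rewrite ?inE ?eqxx.
  + have yQ' := outP _ yQ nyx; rewrite zx in yz.
    by apply: oF yz; rewrite ?inE ?eqxx.
  + by apply: oo => //; apply: outP.
(* An arc from the rest of [F] to [x] contradicts the queue order. *)
- move=> y z yF zQ yz /=; case: (eqVneq z x) => [zx|nzx].
    by have := xF _ yF; rewrite -zx yz.
  have zQ' := outP _ zQ nzx.
  rewrite ltn_neqAle eq_sym (posi _ zQ') /=.
  by apply: Fo yz; rewrite // inE yF orbT.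
- move=> y z yQ zF yz /=; case: (eqVneq y x) => // nyx.
  by rewrite ltnS ltnW //; apply: oF yz; rewrite ?outP // inE zF orbT.
(* An arc from [x] into [B] is what [separated] forbids; one from [B] to [x], in the next item, is
   harmless since [j <= i]. *)
- move=> y z yQ zB yz /=; case: (eqVneq y x) => [yx|nyx].
    have := sep y z; rewrite yx inE eqxx => /(_ isT zB).
    by rewrite -yx yz.
  by apply: oB yz => //; apply: outP.
- move=> y z yB zQ yz /=; case: (eqVneq z x) => // nzx.
  by apply: Bo yz => //; apply: outP.
Qed.

Lemma invariant_place_B (V : finType) (arc : rel V) pos vtx F B i j x :
  irreflexive arc -> 1 <= j <= #|V| -> vtx j = None -> j < i ->
  separated arc F (x :: B) -> invariant arc pos vtx F (x :: B) i j.+1 ->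
  invariant arc [eta pos with x |-> j] [eta vtx with j |-> Some x] F B i j.
Proof.
move=> irr jr vj ji sep [cs [FF BB oo Fo oF oB Bo]].
have pE : perm_eq (F ++ x :: B) (x :: F ++ B) by rewrite perm_catC /= perm_cons perm_catC.
split; first exact: consistent_place pE jr vj cs.
have posj y : y \notin F ++ x :: B -> pos y != j.
  by move=> yQ; apply/eqP => py; have := cs_vtx cs yQ; rewrite py vj.
have outP y : y \notin F ++ B -> y != x -> y \notin F ++ x :: B.
  by move=> yQ nyx; rewrite (perm_mem pE) inE negb_or nyx.
move: BB => /= /andP[/allP xB BB].
split=> //.
- move=> y z yQ zQ yz /=.
  case: (eqVneq y x) => [yx|nyx]; case: (eqVneq z x) => [zx|nzx].
  + by rewrite yx zx irr in yz.
  + have zQ' := outP _ zQ nzx; rewrite yx in yz.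
    by apply: Bo yz; rewrite ?inE ?eqxx.
  + have yQ' := outP _ yQ nyx; rewrite zx in yz.
    rewrite ltn_neqAle (posj _ yQ') /= -ltnS.
    by apply: oB yz; rewrite ?inE ?eqxx.
  + by apply: oo => //; apply: outP.
(* Here [separated] forbids an arc from [F] to [x]; in the next item an arc from [x] into [F] is
   allowed because [j < i]. *)
- move=> y z yF zQ yz /=; case: (eqVneq z x) => [zx|nzx].
    have := sep y z; rewrite zx inE eqxx => /(_ yF isT).
    by rewrite -zx yz.
  by apply: Fo yz => //; apply: outP.
- move=> y z yQ zF yz /=; case: (eqVneq y x) => // nyx.
  by apply: oF yz => //; apply: outP.
- move=> y z yQ zB yz /=; case: (eqVneq y x) => [yx|nyx].
    by have := xB _ zB; rewrite -yx yz.
  have yQ' := outP _ yQ nyx.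
  rewrite ltn_neqAle (posj _ yQ') /= -ltnS.
  by apply: oB yz; rewrite // inE zB orbT.
- move=> y z yB zQ yz /=; case: (eqVneq z x) => // nzx.
  by rewrite ltnW //; apply: Bo yz; rewrite ?outP // inE yB orbT.
Qed.

(** * The search *)

Lemma scan_F_terminates (V : finType) (arc : rel V) pos vtx F B i j :
  1 <= i <= j -> j <= #|V| -> (forall k, i <= k < j -> vtx k != None) ->
  invariant arc pos vtx F B i j ->
  exists k, [/\ i <= k <= j, invariant arc pos vtx F B k j,
    k < j -> exists2 x, vtx k = Some x & has (arc^~ x) F &
    terminates_in (scan_F arc ^~ (State pos vtx F B i j))
      (State pos vtx F B k j)].
Proof.
move=> ij jV nn inv.
(* Only the index moves during a scan. [Q] adds to [P] the reason for stopping: either the indices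
   meet or a suitable arc is found. *)
pose P s := exists k, [/\ s = State pos vtx F B k j, i <= k <= j &
  invariant arc pos vtx F B k j].
pose Q s := exists k, [/\ s = State pos vtx F B k j, i <= k <= j,
  invariant arc pos vtx F B k j &
  k < j -> exists2 x, vtx k = Some x & has (arc^~ x) F].
have [||s' Ht [k [es ikj invk hk]]] := @while_terminates _
    (fun s => if st_i s < st_j s then
                let? x := read_vertex (st_vertex s) (st_i s) in
                Some (~~ arc_from_F arc s x)
              else Some false)
    (fun s => Some (set_i s (st_i s).+1))
    P Q (fun s => j - st_i s) (State pos vtx F B i j); last 1 first.
- by exists k; split=> //; rewrite -es.
- move=> _ [k [-> ikj invk]] /=; rewrite /Q; case: ltnP => kj; last first.
    by left; split=> //; exists k; split=> //; rewrite ltnNge kj.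
  rewrite /read_vertex /read; have -> /= : 1 <= k <= #|V| by lia.
  case vk: (vtx k) => [x|] /=; last by have := nn k; rewrite vk => /(_ ltac:(lia)).
  rewrite /arc_from_F /=; case: hasP => [xF|/hasP nxF] /=.
    left; split=> //; exists k; split=> // _; exists x => //.
    by apply/hasP.
  right; split=> //; exists (State pos vtx F B k.+1 j); split=> //=; last by lia.
  exists k.+1; split=> //; first by lia.
  by apply: invariant_skip_F invk => y; rewrite vk => -[<-].
- by exists i; split=> //; lia.
Qed.

Lemma scan_B_terminates (V : finType) (arc : rel V) pos vtx F B i j :
  1 <= i <= j -> j <= #|V| -> (forall k, i < k <= j -> vtx k != None) ->
  invariant arc pos vtx F B i j.+1 ->
  exists k, [/\ i <= k <= j, invariant arc pos vtx F B i k.+1,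
    i < k -> exists2 x, vtx k = Some x & has (arc x) B &
    terminates_in (scan_B arc ^~ (State pos vtx F B i j))
      (State pos vtx F B i k)].
Proof.
move=> ij jV nn inv.
pose P s := exists k, [/\ s = State pos vtx F B i k, i <= k <= j &
  invariant arc pos vtx F B i k.+1].
pose Q s := exists k, [/\ s = State pos vtx F B i k, i <= k <= j,
  invariant arc pos vtx F B i k.+1 &
  i < k -> exists2 x, vtx k = Some x & has (arc x) B].
have [||s' Ht [k [es ikj invk hk]]] := @while_terminates _
    (fun s => if st_i s < st_j s then
                let? y := read_vertex (st_vertex s) (st_j s) in
                Some (~~ arc_to_B arc s y)
              else Some false)
    (fun s => Some (set_j s (st_j s).-1))
    P Q (fun s => st_j s) (State pos vtx F B i j); last 1 first.
- by exists k; split=> //; rewrite -es.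
- move=> _ [k [-> ikj invk]] /=; rewrite /Q; case: ltnP => ik; last first.
    by left; split=> //; exists k; split=> //; rewrite ltnNge ik.
  rewrite /read_vertex /read; have -> /= : 1 <= k <= #|V| by lia.
  case vk: (vtx k) => [x|] /=; last by have := nn k; rewrite vk => /(_ ltac:(lia)).
  rewrite /arc_to_B /=; case: hasP => [xB|/hasP nxB] /=.
    left; split=> //; exists k; split=> // _; exists x => //.
    by apply/hasP.
  right; split=> //; exists (State pos vtx F B i k.-1); split=> //=; last by lia.
  exists k.-1; split=> //; first by lia.
  have -> : k.-1.+1 = k by lia.
  by apply: invariant_skip_B invk => y; rewrite vk => -[<-].
- by exists j; split=> //; lia.
Qed.

(* The null entries are those from which F (positions <= i) and B (positions
   >= j) were taken. *)
Lemma search_terminates (V : finType) (arc : rel V) pos vtx F B i j v w :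
  1 <= i -> i < j <= #|V| -> vtx i = None -> vtx j = None ->
  (forall k, i < k < j -> vtx k != None) ->
  nulls vtx 1 i.+1 = size F -> nulls vtx j #|V|.+1 = size B ->
  size F = size B ->
  {in F, forall x, connect arc w x} -> {in B, forall y, connect arc y v} ->
  invariant arc pos vtx F B i j ->
  exists vtx' F' B' t,
    [/\ terminates_in (search_loop arc ^~ (State pos vtx F B i j))
          (State pos vtx' F' B' t t),
        1 <= t <= #|V|,
        nulls vtx' t #|V|.+1 = size F' /\ nulls vtx' 1 t = size B',
        {in F', forall x, connect arc w x} /\
          {in B', forall y, connect arc y v} &
        invariant arc pos vtx' F' B' t t].
Proof.
(* Induction on the gap between the indices; each full round narrows it from both sides. *)
have [n] := ubnP (j - i).
elim: n => // n IH in vtx F B i j *.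
move=> ltn i1 ijV vi vj nn nF nB FB wF Bv inv.
have {}inv : invariant arc pos vtx F B i.+1 j.
  by apply: invariant_skip_F inv => x; rewrite vi.
have [i' [ii' {}inv hx [f1 H1]]] : exists k, [/\ i.+1 <= k <= j,
    invariant arc pos vtx F B k j,
    k < j -> exists2 x, vtx k = Some x & has (arc^~ x) F &
    terminates_in (scan_F arc ^~ (State pos vtx F B i.+1 j))
      (State pos vtx F B k j)].
  by apply: scan_F_terminates => //; lia.
have n1 : nulls vtx 1 i' = size F.
  by rewrite -nF (@nulls_skip_r _ _ _ i.+1) //; [lia|move=> k ?; apply: nn; lia].
(* The upward scan met [j], so [t = j]. The null entries below [t] come from [F] and the others from
   [B]; the required counts are the opposite ones, and agree because the queues have equal
   length. *)
case: (eqVneq i' j) => [i'j|ni'j].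
  exists vtx, F, B, j; split=> //; first 2 last.
  - by rewrite -{2}i'j n1 nB.
  - by move: inv; rewrite i'j.
  - exists f1.+1; case=> // fuel lef; rewrite /= H1 //=.
    by rewrite i'j eqxx.
  - lia.
have [|x vi' /hasP[u uF ux]] := hx; first by lia.
have i'V : 1 <= i' <= #|V| by lia.
have {}inv := invariant_inject_F i'V vi' inv.
set vtx1 := [eta vtx with i' |-> None] in inv.
set F1 := rcons F x in inv.
have v1i' : vtx1 i' = None by rewrite /vtx1 /= eqxx.
have v1E k : k != i' -> vtx1 k = vtx k by rewrite /vtx1 /= => /negbTE ->.
have wF1 : {in F1, forall x, connect arc w x}.
  move=> z; rewrite mem_rcons inE => /predU1P[->|/wF //].
  exact: connect_trans (wF _ uF) (connect1 ux).
have sF1 : size F1 = (size F).+1 by rewrite size_rcons.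
have n1' : nulls vtx1 1 i' = size F by rewrite nulls_set // ltnn andbF.
have n2 : nulls vtx1 j #|V|.+1 = size B by rewrite nulls_set //; lia.
have jE : j = j.-1.+1 by lia.
have [j' [jj' {}inv hy [f2 H2]]] : exists k, [/\ i' <= k <= j.-1,
    invariant arc pos vtx1 F1 B i' k.+1,
    i' < k -> exists2 y, vtx1 k = Some y & has (arc y) B &
    terminates_in (scan_B arc ^~ (State pos vtx1 F1 B i' j.-1))
      (State pos vtx1 F1 B i' k)].
  apply: scan_B_terminates; rewrite -?jE //; try lia.
  by move=> k ?; rewrite v1E; [apply: nn; lia|lia].
(* The downward scan met [i'], so [t = i']. Now [F1] is one longer than [B], and the fresh null
   entry at [t] itself accounts for the difference. *)
case: (eqVneq i' j') => [i'j'|ni'j'].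
  exists vtx1, F1, B, i'; split=> //.
  - exists (maxn f1 f2).+1; case=> // fuel lef; rewrite /= H1 /=; last by lia.
    rewrite (negbTE ni'j) /read_vertex /read i'V /= vi' /= H2 /=; last by lia.
    by rewrite -i'j' eqxx.
  - split; last by rewrite n1' FB.
    rewrite nulls_recl; last by lia.
    rewrite v1i' eqxx add1n sF1 FB -n2 (@nulls_skip_l _ _ _ j) //; first by lia.
    by move=> k ?; rewrite v1E; [apply: nn; lia|lia].
  - by rewrite -i'j' in inv; apply: invariant_skip_B inv => y; rewrite v1i'.
have [|y vj' /hasP[z zB yz]] := hy; first by lia.
have j'V : 1 <= j' <= #|V| by lia.
have {}inv := invariant_inject_B j'V vj' inv.
set vtx2 := [eta vtx1 with j' |-> None] in inv.
have v2E k : k != i' -> k != j' -> vtx2 k = vtx k.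
  by move=> ki kj; rewrite -(v1E k) // /vtx2 /= (negbTE kj).
have v2j' : vtx2 j' = None by rewrite /vtx2 /= eqxx.
have v2i' : vtx2 i' = None by rewrite /vtx2 /= (negbTE ni'j').
have {}inv : invariant arc pos vtx2 F1 (rcons B y) i' j'.
  by apply: invariant_skip_B inv => t; rewrite v2j'.
have [||||||||||||vtx' [F' [B' [t [[f3 H3] *]]]]] :=
  IH vtx2 F1 (rcons B y) i' j' => //; try lia.
- by move=> k ?; rewrite v2E; [apply: nn|..]; lia.
- rewrite nulls_set; last by lia.
  by rewrite nulls_recr ?n1' ?v1i' ?eqxx ?sF1 ?addn1 //; lia.
- rewrite nulls_recl ?v2j' ?eqxx; last by lia.
  rewrite nulls_set; last by lia.
  rewrite size_rcons -n2 (@nulls_skip_l _ _ _ j) //; first by lia.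
  by move=> k ?; rewrite v1E; [apply: nn; lia|lia].
- by rewrite sF1 size_rcons FB.
- move=> y'; rewrite mem_rcons inE => /predU1P[->|/Bv //].
  exact: connect_trans (connect1 yz) (Bv _ zB).
exists vtx', F', B', t; split=> //.
(* One unit pays for this round; what is left must suffice for both scans and for the rest of the
   search. *)
exists (maxn f1 (maxn f2 f3)).+1; case=> // fuel lef.
rewrite /= H1 /=; last by lia.
rewrite (negbTE ni'j) /read_vertex /read i'V /= vi' /= H2 /=; last by lia.
have ni : j' != i' by rewrite eq_sym.
rewrite (negbTE ni'j') j'V /= (negbTE ni) -v1E // vj' /=.
by apply: H3; lia.
Qed.

(** * The reordering *)

(** As many null entries remain from [i] on as there are vertices in [F], so a nonempty [F] keeps
    [i] within range. Skipping changes neither number, injecting raises both by one, and placing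
    lowers both by one. *)
Lemma reorder_F_step (V : finType) (arc : rel V) pos vtx F B i j :
  irreflexive arc -> 1 <= j <= i -> F != [::] -> separated arc F B ->
  nulls vtx i #|V|.+1 = size F -> nulls vtx 1 j = size B ->
  invariant arc pos vtx F B i j ->
  exists pos' vtx' F',
    [/\ reorder_F_body arc (State pos vtx F B i j) =
          Some (State pos' vtx' F' B i.+1 j),
        i <= #|V|, separated arc F' B,
        nulls vtx' i.+1 #|V|.+1 = size F' /\ nulls vtx' 1 j = size B &
        invariant arc pos' vtx' F' B i.+1 j].
Proof.
move=> irr ji nF sep n1 n2 inv.
have iV : i <= #|V|.
  rewrite leqNgt; apply/negP => Vi.
  by move: n1 nF; rewrite /nulls big_geq // => /esym/size0nil ->.
have iR : 1 <= i <= #|V| by lia.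
(* Shared by the two ways of meeting a null entry at [i]: it was null already, or its vertex has
   just been injected. *)
have place vtx0 x F0 : vtx0 i = None -> separated arc (x :: F0) B ->
    nulls vtx0 i #|V|.+1 = size (x :: F0) -> nulls vtx0 1 j = size B ->
    invariant arc pos vtx0 (x :: F0) B i j ->
    [/\ separated arc F0 B,
      nulls [eta vtx0 with i |-> Some x] i.+1 #|V|.+1 = size F0 /\
      nulls [eta vtx0 with i |-> Some x] 1 j = size B &
      invariant arc [eta pos with x |-> i] [eta vtx0 with i |-> Some x] F0 B
        i.+1 j].
  move=> v0 sep0 m1 m2 inv0; split.
  - by move=> y z yF; apply: sep0; rewrite inE yF orbT.
  - rewrite !nulls_set; [split=> //|by lia|by lia].
    by move: m1; rewrite nulls_recl // v0 eqxx add1n => -[].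
  - by apply: invariant_place_F => //; lia.
rewrite /reorder_F_body /= /read iR /=.
case vi: (vtx i) => [x|] /=; last first.
  rewrite iR /= vi /=.
  case: F nF sep n1 inv => // x F _ sep n1 inv.
  have [sep' n' inv'] := place _ _ _ vi sep n1 n2 inv.
  by exists [eta pos with x |-> i], [eta vtx with i |-> Some x], F.
rewrite /arc_from_F /=; case: ifP => hF /=.
  rewrite iR /= eqxx /=.
  have inv' := invariant_inject_F iR vi inv.
  have sep' : separated arc (rcons F x) B.
    by apply: separated_inject_F vi inv _ sep => //; lia.
  set vtx1 := [eta vtx with i |-> None] in inv' *.
  have v1 : vtx1 i = None by rewrite /vtx1 /= eqxx.
  have m1 : nulls vtx1 i #|V|.+1 = size (rcons F x).
    rewrite size_rcons -n1 nulls_recl // [in RHS]nulls_recl // v1 vi eqxx add1n add0n.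
    by rewrite nulls_set //; lia.
  have m2 : nulls vtx1 1 j = size B by rewrite nulls_set //; lia.
  (* [F] was nonempty before the injection, so an older vertex [y] is popped, not [x]. *)
  case: F nF {sep n1 inv hF} inv' sep' m1 => // y F _ inv' sep' m1.
  have [sepP n' invP] := place _ _ _ v1 sep' m1 m2 inv'.
  by exists [eta pos with y |-> i], [eta vtx1 with i |-> Some y], (rcons F x).
rewrite iR /= vi /=; exists pos, vtx, F; split=> //.
- by split=> //; rewrite -n1 [RHS]nulls_recl // vi.
- by apply: invariant_skip_F inv => y; rewrite vi => -[<-]; rewrite hF.
Qed.

Lemma reorder_B_step (V : finType) (arc : rel V) pos vtx F B i j :
  irreflexive arc -> j <= i -> j <= #|V|.+1 -> B != [::] -> separated arc F B ->
  nulls vtx 1 j = size B -> invariant arc pos vtx F B i j ->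
  exists pos' vtx' B',
    [/\ reorder_B_body arc (State pos vtx F B i j) =
          Some (State pos' vtx' F B' i j.-1),
        0 < j, separated arc F B', nulls vtx' 1 j.-1 = size B' &
        invariant arc pos' vtx' F B' i j.-1].
Proof.
move=> irr ji jV nB sep n1 inv.
have j1 : 1 < j.
  rewrite ltnNge; apply/negP => j1.
  by move: n1 nB; rewrite /nulls big_geq // => /esym/size0nil ->.
(* The body decrements before reading; after this renaming the cut is [j.+1] and the entry read is
   [j]. *)
case: j => // j in j1 ji jV n1 inv *.
have jR : 1 <= j <= #|V| by lia.
have place vtx0 x B0 : vtx0 j = None -> separated arc F (x :: B0) ->
    nulls vtx0 1 j.+1 = size (x :: B0) ->
    invariant arc pos vtx0 F (x :: B0) i j.+1 ->
    [/\ separated arc F B0,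
      nulls [eta vtx0 with j |-> Some x] 1 j = size B0 &
      invariant arc [eta pos with x |-> j] [eta vtx0 with j |-> Some x] F B0
        i j].
  move=> v0 sep0 m1 inv0; split.
  - by move=> y z yF zB; apply: sep0; rewrite // inE zB orbT.
  - rewrite nulls_set; last by lia.
    by move: m1; rewrite nulls_recr // v0 eqxx addn1 => -[].
  - by apply: invariant_place_B.
rewrite /reorder_B_body /= /read jR /=.
case vj: (vtx j) => [x|] /=; last first.
  rewrite jR /= vj /=.
  case: B nB sep n1 inv => // x B _ sep n1 inv.
  have [sep' n' inv'] := place _ _ _ vj sep n1 inv.
  by exists [eta pos with x |-> j], [eta vtx with j |-> Some x], B.
rewrite /arc_to_B /=; case: ifP => hB /=.
  rewrite jR /= eqxx /=.
  have inv' := invariant_inject_B jR vj inv.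
  have sep' : separated arc F (rcons B x).
    exact: separated_inject_B jR vj inv ji sep.
  set vtx1 := [eta vtx with j |-> None] in inv' *.
  have v1 : vtx1 j = None by rewrite /vtx1 /= eqxx.
  have m1 : nulls vtx1 1 j.+1 = size (rcons B x).
    rewrite size_rcons -n1 nulls_recr // [in RHS]nulls_recr // v1 vj eqxx addn1 addn0.
    by rewrite nulls_set //; lia.
  case: B nB {sep n1 inv hB} inv' sep' m1 => // y B _ inv' sep' m1.
  have [sepP n' invP] := place _ _ _ v1 sep' m1 inv'.
  by exists [eta pos with y |-> j], [eta vtx1 with j |-> Some y], (rcons B x).
rewrite jR /= vj /=; exists pos, vtx, B; split=> //.
- by rewrite -n1 [RHS]nulls_recr // vj addn0.
- by apply: invariant_skip_B inv => y; rewrite vj => -[<-]; rewrite hB.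
Qed.

Lemma reorder_terminates (V : finType) (arc : rel V) pos vtx F B t :
  irreflexive arc -> 1 <= t <= #|V| -> separated arc F B ->
  nulls vtx t #|V|.+1 = size F -> nulls vtx 1 t = size B ->
  invariant arc pos vtx F B t t ->
  exists s', terminates_in (reorder arc (State pos vtx F B t t)) s' /\
    invariant arc (st_position s') (st_vertex s') [::] [::] (st_i s') (st_j s').
Proof.
move=> irr tV sep n1 n2 inv.
(* The first loop leaves [j] alone, and carries along the count of null entries below [j] for the
   second loop. *)
pose PF (s : state V) := let: State pos vtx F B i j := s in
  [/\ 1 <= j <= i /\ j <= #|V|, separated arc F B,
    nulls vtx i #|V|.+1 = size F /\ nulls vtx 1 j = size B &
    invariant arc pos vtx F B i j].
pose PB (s : state V) := let: State pos vtx F B i j := s in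
  [/\ F = [::], j <= i /\ j <= #|V|, nulls vtx 1 j = size B &
    invariant arc pos vtx F B i j].
have [||s1 [f1 H1] [PF1 F1]] := @while_terminates _
    (fun s => Some (st_F s != [::])) (reorder_F_body arc) PF
    (fun s => PF s /\ st_F s = [::]) (fun s => #|V|.+1 - st_i s)
    (State pos vtx F B t t).
- move=> [pos0 vtx0 F0 B0 i j] PFs; have [[ji jV] sep0 [m1 m2] inv0] := PFs.
  have [F00|nF] := eqVneq F0 [::]; first by left; rewrite F00 in PFs *.
  have [pos' [vtx' [F' [-> iV sep' n' inv']]]] :=
    reorder_F_step irr ji nF sep0 m1 m2 inv0.
  right; split=> //.
  exists (State pos' vtx' F' B0 i.+1 j); split=> //; last exact: ltn_sub2l.
  by split=> //; lia.
- by split=> //; lia.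
have PB1 : PB s1.
  by case: s1 F1 PF1 {H1} => ? ? ? ? ? ? /= -> [[/andP[_ ?] ?] _ [_ ?] ?].
have [|s2 [f2 H2] [PB2 B2]] := @while_terminates _
    (fun s => Some (st_B s != [::])) (reorder_B_body arc) PB
    (fun s => PB s /\ st_B s = [::]) (fun s => st_j s) s1 _ PB1.
- move=> [pos0 vtx0 F0 B0 i j] PBs; have [F0E [ji jV] m2 inv0] := PBs.
  have [B00|nB] := eqVneq B0 [::]; first by left; rewrite B00 in PBs *.
  (* Separation holds trivially once [F] has been emptied. *)
  have sep0 : separated arc F0 B0 by rewrite F0E.
  have [|pos' [vtx' [B' [-> j0 sep' n' inv']]]] :=
    reorder_B_step irr ji _ nB sep0 m2 inv0; first by lia.
  right; split=> //.
  exists (State pos' vtx' F0 B' i j.-1); split=> //; last by rewrite /= prednK.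
  by split=> //; split; apply: leq_trans (leq_pred j) _.
exists s2; split.
  by exists (maxn f1 f2) => f lef; rewrite /reorder H1 /= ?H2 //; lia.
by case: s2 PB2 B2 {H2} => ? ? ? ? ? ? /= [FE _ _ inv2] BE; rewrite FE BE in inv2.
Qed.

(** * Numberings and cycles *)

(** With empty queues [vtx] inverts [pos], which is therefore injective; it is onto because its
    values form a duplicate-free list of length n inside 1..n. *)
Lemma consistent_numbering (V : finType) (pos : V -> nat) vtx :
  consistent pos vtx [::] [::] -> numbering pos vtx.
Proof.
move=> cs; have inj : injective pos.
  move=> x y exy; have := cs_vtx cs (x := x) isT.
  by rewrite exy (cs_vtx cs) // => -[].
split=> //; try by move=> x; apply: (cs_range cs) || apply: (cs_vtx cs).
move=> k kR.
have := @uniq_min_size _ (map pos (enum V)) (iota 1 #|V|).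
rewrite map_inj_uniq // enum_uniq size_iota size_map -cardE leqnn => /(_ isT).
case=> // [y /mapP[x _ ->]|_ kE].
  by rewrite mem_iota add1n ltnS (cs_range cs).
have : k \in map pos (enum V) by rewrite kE mem_iota add1n ltnS.
by case/mapP => x _ ->; exists x.
Qed.

(** All arcs other than the new one go up. The new arc leads from [B] to [F], a direction that
    [ordered] leaves unconstrained. *)
Lemma numbering_invariant (V : finType) (arc : rel V) pos vtx v w :
  numbering pos vtx -> topological arc pos -> pos w < pos v ->
  invariant (add_arc arc v w) pos
    [eta vtx with pos w |-> None, pos v |-> None] [:: w] [:: v]
    (pos w) (pos v).
Proof.
move=> [rg inj surj vt] top lt.
have nwv : w != v by apply: contraTneq lt => ->; rewrite ltnn.
have addE x y : add_arc arc v w x y -> (x != v) || (y != w) -> pos x < pos y.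
  by rewrite /add_arc -negb_and => /orP[/top|->].
have inE2 x : (x \notin [:: w] ++ [:: v]) = (x != w) && (x != v).
  by rewrite !inE negb_or.
have posE x y : (pos x == pos y) = (x == y) by rewrite inj_eq.
split; split.
- by rewrite /= inE nwv.
- by move=> x _; apply: rg.
- by move=> x; rewrite inE2 => /andP[/negbTE xw /negbTE xv] /=; rewrite !posE xw xv vt.
- move=> k x kR /=; case: eqP => // kw; case: eqP => // kv.
  have [y yk] := surj k kR; rewrite -yk vt => -[yx]; rewrite inE2 -!posE -yx yk.
  by apply/andP; split; apply/eqP.
- move=> k x kR /=; case: eqP => // _; case: eqP => // _.
  by have [y <-] := surj k kR; rewrite vt => -[->].
- by [].
- by [].
- by move=> x y; rewrite !inE2 => /andP[_ xv] _ /addE; apply; rewrite xv.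
- move=> x y; rewrite inE2 inE => /eqP -> /andP[yw _] /addE h.
  by rewrite ltnW ?h // yw orbT.
- by move=> x y; rewrite inE2 inE => /andP[_ xv] /eqP -> /addE; apply; rewrite xv.
- by move=> x y; rewrite inE2 inE => /andP[_ xv] /eqP -> /addE; apply; rewrite xv.
- move=> x y; rewrite inE2 inE => /eqP -> /andP[yw _] /addE h.
  by rewrite ltnW ?h // yw orbT.
Qed.

(** Positions increase strictly along a path, so none returns to its start. *)
Lemma topological_acyclic (V : finType) (arc : rel V) (pos : V -> nat) :
  topological arc pos -> acyclic arc.
Proof.
move=> top [x [p /= px]].
have /(order_path_min ltn_trans)/allP/(_ (pos x)) :=
  @homo_path _ _ pos arc ltn x (rcons p x) top px.
by rewrite ltnn map_rcons mem_rcons inE eqxx => /(_ isT).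
Qed.

Lemma connect_has_cycle (V : finType) (arc : rel V) (v w : V) :
  connect arc w v -> arc v w -> has_cycle arc.
Proof.
by case/connectP => p wp -> vw; exists w, p; rewrite /= rcons_path wp vw.
Qed.
Unset Implicit Arguments.

Theorem theorem5p1 (V : finType) (arc : rel V) (position : V -> nat)
    (vertex : nat -> option V) (v w : V)
    (hnum : numbering position vertex)
    (hacyclic : acyclic arc)
    (htop : topological arc position)
    (hvw : position w < position v) :
  exists s : state V,
    [/\ terminates_in (search (add_arc arc v w) position vertex v w) s,
        cycle_test (add_arc arc v w) s <-> has_cycle (add_arc arc v w) &
        ~ has_cycle (add_arc arc v w) ->
        exists s' : state V,
          [/\ terminates_in (reorder (add_arc arc v w) s) s',
              numbering (st_position s') (st_vertex s') &
              topological (add_arc arc v w) (st_position s')]].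
Proof.
have [rg _ _ vt] := hnum.
have irr : irreflexive (add_arc arc v w).
  move=> x; rewrite /add_arc; case: eqP => [->|_].
    case: eqP => [vw|_]; first by rewrite vw ltnn in hvw.
    by apply/negP; rewrite orbF => /htop; rewrite ltnn.
  by apply/negP; rewrite orbF => /htop; rewrite ltnn.
set vtx0 := [eta vertex with position w |-> None, position v |-> None].
have v0E k : 1 <= k <= #|V| -> k != position w -> k != position v ->
    vtx0 k != None.
  move=> kR kw kv; rewrite /vtx0 /= (negbTE kw) (negbTE kv).
  by have [x <-] := position_surj hnum kR; rewrite vt.
have rw := rg w; have rv := rg v.
have v0w : vtx0 (position w) = None by rewrite /vtx0 /= eqxx.
have v0v : vtx0 (position v) = None by rewrite /vtx0 /= eqxx; case: ifP.
have [|||||||||||vtx [F [B [t [Hs tV [n1 n2] [wF Bv] inv]]]]] :=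
  @search_terminates V (add_arc arc v w) position vtx0 [:: w] [:: v]
    (position w) (position v) v w => //; try lia.
- by move=> k ?; apply: v0E; lia.
(* Initially only the entries of [w] and [v] are null, so both counts are 1. *)
- rewrite nulls_recr ?v0w; last by lia.
  rewrite (@nulls_skip_r _ _ _ 1) /nulls ?big_geq //; first by lia.
  by move=> k ?; apply: v0E; lia.
- rewrite nulls_recl ?v0v; last by lia.
  rewrite (@nulls_skip_l _ _ _ #|V|.+1) /nulls ?big_geq //; first by lia.
  by move=> k ?; apply: v0E; lia.
- by move=> x; rewrite inE => /eqP ->.
- by move=> x; rewrite inE => /eqP ->.
- exact: numbering_invariant.
exists (State position vtx F B t t).
have test_cycle : cycle_test (add_arc arc v w) (State position vtx F B t t) ->
    has_cycle (add_arc arc v w).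
  case/hasP => u uF /hasP[z zB uz]; apply: (@connect_has_cycle _ _ v w).
    apply: connect_trans (wF _ uF) _.
    exact: connect_trans (connect1 uz) (Bv _ zB).
  by rewrite /add_arc !eqxx orbT.
(* Derived from the negative test alone, not from acyclicity. It thus serves twice: for the
   reordering claim, and to refute a cycle missed by the test, since a topological numbering
   excludes cycles. *)
have test_reorder :
    ~~ cycle_test (add_arc arc v w) (State position vtx F B t t) ->
    exists s' : state V,
      [/\ terminates_in (reorder (add_arc arc v w)
            (State position vtx F B t t)) s',
          numbering (st_position s') (st_vertex s') &
          topological (add_arc arc v w) (st_position s')].
  move=> /hasPn nc.
  have sep : separated (add_arc arc v w) F B.
    by move=> x y xF yB; have /hasPn := nc _ xF; apply.
  have [s' [Hr [cs od]]] := reorder_terminates irr tV sep n1 n2 inv.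
  exists s'; split=> //; first exact: consistent_numbering cs.
  (* With both queues empty every vertex is free. *)
  by move=> x y; apply: (or_out od).
split=> //.
- split=> // hc; apply/negPn/negP => /test_reorder[s' [_ _ /topological_acyclic]].
  exact.
- by move=> nhc; apply: test_reorder; apply/negP => /test_cycle.
Qed.
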